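(* Let $k$ be a positive integer and let $G$ be a simple $k$-connected graph of order $n\geq 3$ with minimum degree $\delta=\delta(G)$. If $$\lambda_{1}(G)\leq \delta\sqrt{\frac{k}{n-k}},$$ then $G$ is Hamiltonian-connected if and only if $G\ncong K_{k,k}$.
   Context: All graphs are simple, undirected and connected. A graph $G$ is $k$-connected if its vertex connectivity $\kappa(G)$ satisfies $\kappa(G)\geq k$. $\lambda_1(G)$ denotes the spectral radius (largest eigenvalue) of the adjacency matrix of $G$. A graph is Hamiltonian-connected if every two distinct vertices are joined by a Hamiltonian path (a path through all vertices). $K_{a,b}$ denotes the complete bipartite graph with parts of sizes $a$ and $b$. (In the paper the bound is written as $\delta\sqrt{\frac{k-s+1}{n-k+s-1}}$ with $s=1$.) *)

(* Defs.v *)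
From mathcomp Require Import all_boot all_order all_algebra.
From mathcomp Require Import classical_sets reals.

Set Implicit Arguments.
Unset Strict Implicit.
Unset Printing Implicit Defensive.

Import Order.TTheory GRing.Theory Num.Theory.

Record sgraph := SGraph {
  vertex :> finType;
  adj : rel vertex;
  adj_sym : symmetric adj;
  adj_irrefl : irreflexive adj
}.

Definition graph_iso (G H : sgraph) : Prop :=
  exists2 f : G -> H, bijective f & forall x y, adj (f x) (f y) = adj x y.

Section Induced.
Variables (G : sgraph) (A : {set G}).

Definition induced_adj : rel {x : G | x \in A} :=
  [rel x y | adj (val x) (val y)].

Lemma induced_adj_sym : symmetric induced_adj.
Proof. by move=> x y; exact: adj_sym. Qed.

Lemma induced_adj_irrefl : irreflexive induced_adj.
Proof. by move=> x; exact: adj_irrefl. Qed.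

Definition induced : sgraph := SGraph induced_adj_sym induced_adj_irrefl.
End Induced.

Section CompleteBipartite.
Variables a b : nat.

Definition complete_bipartite_adj : rel ('I_a + 'I_b)%type :=
  fun x y => match x, y with
             | inl _, inr _ | inr _, inl _ => true
             | _, _ => false
             end.

Lemma complete_bipartite_adj_sym : symmetric complete_bipartite_adj.
Proof. by case=> ? []. Qed.

Lemma complete_bipartite_adj_irrefl : irreflexive complete_bipartite_adj.
Proof. by case. Qed.

Definition complete_bipartite : sgraph :=
  SGraph complete_bipartite_adj_sym complete_bipartite_adj_irrefl.
End CompleteBipartite.

Definition connected_graph (G : sgraph) : bool :=
  [forall x : G, forall y : G, connect (@adj G) x y].

(* Removing S leaves a disconnected graph or at most one vertex; with the
   second alternative, the complete graph on n vertices has connectivity n - 1. *)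
Definition separating (G : sgraph) (S : {set G}) : bool :=
  (#|~: S| <= 1) || ~~ connected_graph (induced (~: S)).

(* The full vertex set is separating, so the default value #|G| never
   undercuts or exceeds the minimum. *)
Definition vertex_connectivity (G : sgraph) : nat :=
  \big[minn/#|G|]_(S : {set G} | separating S) #|S|.

Definition k_connected (k : nat) (G : sgraph) : Prop :=
  k <= vertex_connectivity G.

Definition degree (G : sgraph) (x : G) : nat := #|[set y | adj x y]|.

(* Degrees are smaller than #|G|, so the default value only matters for the
   graph with no vertices. *)
Definition min_degree (G : sgraph) : nat :=
  \big[minn/#|G|]_(x : G) degree x.

Definition hamiltonian_path (G : sgraph) (x y : G) (p : seq G) : Prop :=
  [/\ path (@adj G) x p, last x p = y, uniq (x :: p)
    & forall z : G, z \in x :: p].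

Definition hamiltonian_connected (G : sgraph) : Prop :=
  forall x y : G, x != y -> exists p : seq G, hamiltonian_path x y p.

Local Open Scope ring_scope.

Definition adjacency_matrix (R : realType) (G : sgraph) : 'M[R]_#|G| :=
  \matrix_(i, j) (adj (enum_val i) (enum_val j))%:R.

(* The set of eigenvalues is finite, and nonempty when G has a vertex since
   the matrix is real symmetric, so this supremum is the largest eigenvalue. *)
Definition spectral_radius (R : realType) (G : sgraph) : R :=
  sup [set a : R | eigenvalue (adjacency_matrix R G) a]%classic.

(* Main.v *)
(** Let [m = n - k].  If no Hamiltonian path joins [x] to [y], take a longest
    [x]-[y] path, a component [H] of its complement, and the set [N] of its
    vertices with a neighbour in [H].  By maximality the successors of [N] on
    the path are pairwise nonadjacent and not adjacent to [H], and [N] cannot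
    contain two consecutive vertices; so [N] separates [H] from the rest of the
    path, [N] has at least [k] elements, and [k] independent vertices [I] are
    obtained (Chvatal-Erdos).  The Rayleigh quotient of the vector equal to
    [sqrt m] on [I] and [sqrt k] off [I] is at least [delta * sqrt (k / m)],
    with equality only if the complement of [I] is independent too and sends at
    most [k * delta] edges to [I].  As all degrees are at least
    [delta >= k], this forces [m = k] and [G] to be complete bipartite. *)

Require Import Defs.
From mathcomp Require Import classical_sets reals.
From mathcomp Require Import all_boot all_order all_algebra.
From mathcomp Require Import spectral complex polyrcf.
From mathcomp Require Import zify ring lra.

Set Implicit Arguments.
Unset Strict Implicit.
Unset Printing Implicit Defensive.

Import Order.TTheory GRing.Theory Num.Theory.

(** * Bounds for iterated minima *)

Lemma geq_bigminn (I : finType) (P : pred I) (F : I -> nat) m j :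
  P j -> \big[minn/m]_(i | P i) F i <= F j.
Proof.
move=> Pj; have : j \in index_enum I by rewrite mem_index_enum.
elim: (index_enum I) => //= i r IH; rewrite inE big_cons.
case/predU1P => [<- | /IH le_j]; first by rewrite Pj geq_minl.
by case: ifP => // _; apply: leq_trans (geq_minr _ _) le_j.
Qed.

Lemma leq_bigminn (I : finType) (F : I -> nat) m b :
  b <= m -> (forall i, b <= F i) -> b <= \big[minn/m]_i F i.
Proof.
by move=> bm bF; apply: (big_ind (leq b)) => // x y bx bz; rewrite leq_min bx.
Qed.

(** * Longest paths and independent sets *)

Section Paths.
Variables (G : sgraph).
Implicit Types (x y a b c : G) (p q : seq G).
Local Notation e := (@adj G).

Lemma path_insert x p c q a r :
    path e x (p ++ a :: r) -> path e c q ->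
    e (last x p) c -> e (last c q) a ->
  path e x (p ++ (c :: q) ++ a :: r).
Proof.
by rewrite !cat_path /= => /and3P[-> _ ->] -> -> ->; rewrite andbT.
Qed.

(** Reversing the segment [a :: p2] frees both its ends: its last vertex is entered from the detour
    [c :: q], and its first one is left by the chord from [a] to [b]. *)
Lemma path_reroute x p1 a p2 b p3 c q :
    path e x (p1 ++ (a :: p2) ++ b :: p3) -> path e c q ->
    e (last x p1) c -> e (last c q) (last a p2) -> e a b ->
  path e x (p1 ++ (c :: q) ++ rev (a :: p2) ++ b :: p3).
Proof.
rewrite !cat_path /= => /and4P[-> /andP[_ ap2] _ ->] -> -> cl ab.
rewrite lastI rev_rcons /= cl rev_path.
have -> : path (fun z => e^~ z) a p2 = path e a p2.
  by apply: eq_path => u v; rewrite /= adj_sym.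
rewrite ap2 /=.
case: p2 {ap2 cl} => [|d p2] /=; first by rewrite ab.
by rewrite rev_cons last_rcons ab.
Qed.

Lemma bipartite_path (col : G -> bool) x p :
    (forall u v, e u v -> col u != col v) -> path e x p ->
  col (last x p) = odd (size p) (+) col x.
Proof.
move=> colP; elim: p x => //= y p IH x /andP[/colP xy /IH ->].
by move: xy; case: (col x); case: (col y); case: (odd _).
Qed.
End Paths.

(** * Separating sets, connectivity and degrees *)

(** Edges leaving [H] end in [S], so a walk that avoids [S] and starts at [h] stays in [H] and never
    reaches [w]. *)
Lemma isolated_side_separating (G : sgraph) (H S : {set G}) h w :
    h \in H -> w \notin H -> w \notin S -> [disjoint H & S] ->
    (forall u v, u \in H -> adj u v -> v \in H :|: S) ->
  separating S.
Proof.
move=> hH wH wS dHS closedH; apply/orP; right; apply/negP => conn.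
have hS : h \in ~: S by rewrite inE (disjointFr dHS hH).
have wS' : w \in ~: S by rewrite inE.
move/forallP/(_ (Sub h hS))/forallP/(_ (Sub w wS')): conn.
case/connectP => p pth lw.
suff : val (last (Sub h hS : {x | x \in ~: S}) p) \in H by rewrite -lw (negPf wH).
move: (Sub h hS) pth (hH : val (Sub h hS : {x | x \in ~: S}) \in H) {lw}.
elim: p => //= z p IH u /andP[uz zp] uH; apply: IH => //.
have := closedH _ _ uH uz; rewrite inE => /orP[] // zS.
by have := valP z; rewrite inE zS.
Qed.

(** Deleting the neighbours of [x] isolates it from any other remaining vertex; if none remains, the
    first alternative of [separating] applies. *)
Lemma k_connected_leq_degree k (G : sgraph) (x : G) :
  k_connected k G -> k <= degree x.
Proof.
move=> kG; apply: leq_trans kG _; apply: geq_bigminn.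
set S := [set y | adj x y].
have [le1|lt1] := leqP #|~: S| 1; first by rewrite /separating le1.
have xS : x \in ~: S by rewrite !inE adj_irrefl.
have [w] : exists w, w \in (~: S) :\ x.
  by apply/set0Pn; rewrite -card_gt0; move: lt1; rewrite (cardsD1 x) xS.
rewrite in_setD1 in_setC => /andP[wx wS].
apply: (@isolated_side_separating _ [set x] S x w) => //.
- by rewrite set11.
- by rewrite in_set1.
- by rewrite disjoints1 -in_setC.
- by move=> u v /set1P -> uv; rewrite !inE uv orbT.
Qed.

(** The inequality is strict because [x] is not its own neighbour; it makes [n - k] positive in the
    spectral bound. *)
Lemma k_connected_lt_order k (G : sgraph) (x : G) :
  k_connected k G -> k < #|G|.
Proof.
move=> kG; apply: leq_ltn_trans (k_connected_leq_degree x kG) _.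
rewrite ltnNge; apply/negP => le_deg.
have : x \in [set y | adj x y].
  suff -> : [set y | adj x y] = setT by [].
  by apply/eqP; rewrite eqEcard subsetT cardsT.
by rewrite inE adj_irrefl.
Qed.

(** * The Chvatal-Erdos argument on a longest path *)

Definition independent (G : sgraph) (I : {set G}) : Prop :=
  {in I &, forall u v, ~~ adj u v}.

Section ChvatalErdos.
Variables (G : sgraph) (k : nat).
Hypothesis kG : k_connected k G.
Local Notation e := (@adj G).

Variables (x y : G) (p : seq G).
Hypotheses (xy : x != y) (xp : path e x p) (lp : last x p = y)
  (up : uniq (x :: p)).
Hypothesis p_max : forall q, path e x q -> last x q = y -> uniq (x :: q) ->
  size q <= size p.
Variable h : G.
Hypothesis hp : h \notin x :: p.

(** The relation lives on all of [G], with the path vertices isolated, so that components off the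
    path are plain [connect] classes and no induced subgraph is needed. *)
Let off := [rel u v | [&& e u v, u \notin x :: p & v \notin x :: p]].
Let H := [set z | connect off h z].
Let N := [set u in x :: p | [exists z in H, e u z]].

Lemma off_component_avoids z : z \in H -> z \notin x :: p.
Proof.
rewrite inE => /connectP[q hq ->]; elim: q h hp hq => //= a q IH b _.
by case/andP => /and3P[_ _ ap] /IH; apply.
Qed.

(** Neighbours of [u] and [v] in the component [H] are joined inside [H]; they may coincide, and
    then [q] is empty. *)
Lemma attachment_detour u v : u \in N -> v \in N ->
  exists c q, [/\ path e c q, e u c, e (last c q) v, uniq (c :: q)
    & {in c :: q, forall z, z \notin x :: p}].
Proof.
rewrite !inE => /andP[_ /exists_inP[c cH uc]] /andP[_ /exists_inP[d dH vd]].
have off_sym : symmetric off by move=> a b; rewrite /= adj_sym [X in _ && X]andbC.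
have : connect off c d.
  move: cH dH; rewrite !inE (sym_connect_sym off_sym); exact: connect_trans.
case/connectP => q0 /shortenP[q cq uq _] lq.
exists c, q; split => //.
- by apply: sub_path cq => a b /andP[].
- by rewrite -lq adj_sym.
move=> z zcq; apply: off_component_avoids.
case/splitPl: zcq cq => q1 q2 lz; rewrite cat_path => /andP[cq1 _].
rewrite inE in cH; rewrite inE; apply: connect_trans cH _.
by apply/connectP; exists q1.
Qed.

(** Such a path would keep all old vertices and gain at least [c], against maximality. Asking only
    for [perm_eq] lets the old vertices be reordered, as rerouting requires. *)
Lemma no_detour p1 c q s :
    path e x (p1 ++ (c :: q) ++ s) -> last x (p1 ++ (c :: q) ++ s) = y ->
    perm_eq (x :: p1 ++ s) (x :: p) -> uniq (c :: q) ->
    {in c :: q, forall z, z \notin x :: p} -> False.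
Proof.
move=> pth lst perm uq qp; have := p_max pth lst.
rewrite -cat_cons uniq_catCA cat_uniq uq cat_cons (perm_uniq perm) up andbT /=.
have -> /= : ~~ has (mem (c :: q)) (x :: p1 ++ s).
  by rewrite (perm_has _ perm) -all_predC; apply/allP => z; apply: contraL => /qp.
move/(_ isT); move/perm_size: perm => /= [<-]; rewrite !size_cat /= size_cat; lia.
Qed.

Lemma no_insertion p1 a r : p = p1 ++ a :: r ->
  last x p1 \in N -> a \in N -> False.
Proof.
move=> def_p uN aN; have [c [q [cq uc qa uq qp]]] := attachment_detour uN aN.
apply: (@no_detour p1 c q (a :: r)) => //.
- by apply: path_insert => //; rewrite -def_p.
- by rewrite -lp def_p !last_cat.
- by rewrite def_p.
Qed.

(** Here [a] and [b] are the successors of two attachment vertices. Were they adjacent, one could go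
    from the first attachment vertex through [H] to the second, back to [a], and on to [b]. *)
Lemma no_reroute p1 a p2 b p3 : p = p1 ++ (a :: p2) ++ b :: p3 ->
  last x p1 \in N -> last a p2 \in N -> ~~ e a b.
Proof.
move=> def_p uN vN; apply/negP => ab.
have [c [q [cq uc qa uq qp]]] := attachment_detour uN vN.
apply: (@no_detour p1 c q (rev (a :: p2) ++ b :: p3)) => //.
- by apply: path_reroute => //; rewrite -def_p.
- by rewrite -lp def_p !last_cat.
- by rewrite def_p -!cat_cons perm_cat2l perm_cat2r perm_rev.
Qed.

(* With [s = x :: p], the path successor of [nth x s i] is [nth x p i]. *)
Let s := x :: p.

Lemma nth_successor_notin_N i : i < size p -> nth x s i \in N ->
  nth x p i \notin N.
Proof.
move=> ip iN; apply/negP => aN.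
apply: (@no_insertion (take i p) (nth x p i) (drop i.+1 p)) => //.
  by rewrite -drop_nth // cat_take_drop.
by rewrite (last_nth x) size_takel ?(ltnW ip) // -[x :: take i p]/(take i.+1 s) nth_take.
Qed.

Lemma successors_nonadjacent i j : i < size p -> j < size p ->
  nth x s i \in N -> nth x s j \in N -> ~~ e (nth x p i) (nth x p j).
Proof.
wlog: i j / i <= j.
  move=> wl ip jp iN jN; case: (leqP i j) => [|/ltnW] ij; first exact: wl.
  by rewrite adj_sym; apply: wl.
rewrite leq_eqVlt => /predU1P[-> | ij] ip jp iN jN; first by rewrite adj_irrefl.
pose a := nth x p i; pose b := nth x p j.
apply: (@no_reroute (take i p) a (take (j - i.+1) (drop i.+1 p)) b (drop j.+1 p)).
- rewrite -[LHS](cat_take_drop i) (drop_nth x ip) cat_cons; congr (_ ++ _ :: _).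
  rewrite -[LHS](cat_take_drop (j - i.+1)) drop_drop subnK //; congr (_ ++ _).
  by rewrite (drop_nth x jp).
- by rewrite (last_nth x) size_takel ?(ltnW ip) // -[x :: take i p]/(take i.+1 s) nth_take.
rewrite (last_nth x) size_takel; last by rewrite size_drop; lia.
have -> : a :: take (j - i.+1) (drop i.+1 p) = take (j - i.+1).+1 (drop i p).
  by rewrite (drop_nth x ip).
(* The reversed segment ends at position [j.-1] of [p], which is position [j] of [s]: the attachment
   vertex just before [b]. *)
rewrite nth_take // nth_drop; have -> : i + (j - i.+1) = j.-1 by lia.
by move: jN; rewrite -{1}(ltn_predK ij).
Qed.

(** The set consists of [h] and the successors of the vertices of [N]. Only [y] has no successor,
    and [h] makes up for that loss. *)
Lemma independent_of_maximal : exists I : {set G}, independent I /\ k <= #|I|.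
Proof.
pose J := [set i : 'I_(size p) | nth x s i \in N].
pose succ (i : 'I_(size p)) := nth x p i.
have injp : injective succ.
  move=> i j /eqP; rewrite nth_uniq // => [/eqP/val_inj //|].
  by case/andP: up.
have outH i : i < size p -> nth x p i \notin H.
  move=> ip; apply: contraL (mem_nth x ip) => /off_component_avoids.
  by apply: contra; rewrite inE orbC => ->.
have hH : h \in H by rewrite inE.
have adjh i : i < size p -> nth x s i \in N -> ~~ e (nth x p i) h.
  move=> ip iN; apply: contra (nth_successor_notin_N ip iN) => ih.
  by rewrite !inE mem_nth ?orbT //; apply/exists_inP; exists h.
exists (h |: (succ @: J)); split.
  move=> u v /setU1P[-> | /imsetP[i + ->]] /setU1P[-> | /imsetP[j + ->]].
  - by rewrite adj_irrefl.
  - by rewrite inE adj_sym => jN; apply: adjh.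
  - by rewrite inE => iN; apply: adjh.
  by rewrite !inE => jN iN; apply: successors_nonadjacent; rewrite ?inE.
rewrite cardsU1 card_imset //.
have -> /= : h \notin (succ @: J).
  by apply/imsetP => -[i _ hE]; have := outH i (ltn_ord i); rewrite -[nth _ _ _]hE hH.
have kN : k <= #|N|.
  apply: leq_trans kG _; apply: geq_bigminn.
  (* For [N] to separate, a path vertex must lie outside it: [x] itself, or else the vertex after
     [x], which exists because [x != y]. *)
  have [w wp wN] : exists2 w, w \in x :: p & w \notin N.
    have [xN|] := boolP (x \in N); last by exists x; rewrite ?mem_head.
    have p_gt0 : 0 < size p by case: (p) lp xy => //= ->; rewrite eqxx.
    exists (nth x p 0); last exact: nth_successor_notin_N.
    by rewrite inE mem_nth ?orbT.
  apply: (@isolated_side_separating _ H N h w) => //.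
  - by apply: contraL wp => /off_component_avoids.
  - rewrite disjoint_subset; apply/subsetP => z /off_component_avoids.
    by apply: contra; rewrite inE => /andP[].
  move=> u v uH uv; rewrite inE; have up' := off_component_avoids uH.
  have [vp|vp] := boolP (v \in x :: p).
    apply/orP; right; rewrite inE vp; apply/exists_inP; exists u => //.
    by rewrite adj_sym.
  apply/orP; left; rewrite !inE in uH *; apply: connect_trans uH _.
  by apply: connect1; rewrite /= uv up'.
suff le_NJ : #|N| <= #|J|.+1 by rewrite add1n; apply: leq_trans le_NJ.
rewrite (cardsD1 y N) -[#|J|](card_imset (f := fun i : 'I_(size p) => nth x s i)).
  apply: (@leq_trans (1 + #|N :\ y|)); first by rewrite leq_add2r leq_b1.
  rewrite add1n ltnS; apply/subset_leq_card/subsetP => z /setD1P[zy zN].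
  have zs : z \in s by move: zN; rewrite inE => /andP[].
  have iz : index z s < size p.
    move: (zs); rewrite -index_mem /= ltnS leq_eqVlt => /predU1P[iz|//].
    by case/eqP: zy; rewrite -lp (last_nth x) -iz nth_index.
  apply/imsetP; exists (Ordinal iz); rewrite /= ?nth_index //.
  by rewrite in_set /= nth_index.
move=> i j /eqP; rewrite nth_uniq ?ltnS // 1?ltnW // => /eqP/val_inj //.
Qed.
End ChvatalErdos.

Lemma hamiltonian_path_or_independent (G : sgraph) k (x y : G) :
    k_connected k G -> connected_graph G -> x != y ->
  (exists p, hamiltonian_path x y p) \/
  (exists I : {set G}, independent I /\ k <= #|I|).
Proof.
move=> kG /forallP/(_ x)/forallP/(_ y) xy neq_xy.
(* Tuples of a fixed length form a finite type, so path existence is boolean and a maximal length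
   can be extracted. *)
pose xy_path m := [exists q : m.-tuple G,
  [&& path (@adj G) x q, last x q == y & uniq (x :: q)]].
have ex_path : exists m, xy_path m.
  case/connectP: xy => q0 /shortenP[q xq uq _] lq; exists (size q).
  by apply/existsP; exists (in_tuple q); rewrite /= xq -lq eqxx.
have ub_path m : xy_path m -> m <= #|G|.
  case/existsP=> q /and3P[_ _ uq]; rewrite -(size_tuple q) ltnW //.
  by rewrite -[(size q).+1]/(size (x :: q)) -(card_uniqP uq) max_card.
case: (ex_maxnP ex_path ub_path) => m /existsP[p /and3P[xp /eqP lp up]] max_m.
have [ham|] := boolP [forall z, z \in x :: p].
  by left; exists p; split => //; apply/forallP.
case/forallPn => h hp; right.
refine (independent_of_maximal kG neq_xy xp lp up _ hp) => q xq lq uq.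
rewrite size_tuple; apply: max_m; apply/existsP; exists (in_tuple q).
by rewrite /= xq lq eqxx.
Qed.

(** * Complete bipartite graphs *)

(** Parity: a path between two vertices of the same side has an even number of edges, while a
    Hamiltonian path has [2k - 1]. Two such vertices exist since [2 <= k]. *)
Lemma complete_bipartite_not_hamiltonian_connected (G : sgraph) k :
  2 <= k -> graph_iso G (complete_bipartite k k) -> ~ hamiltonian_connected G.
Proof.
case: k => [|[|k]] // _ [f f_bij f_adj] hamG.
pose col u := if f u is inl _ then true else false.
have colP u v : adj u v -> col u != col v.
  by rewrite -f_adj /col; case: (f u); case: (f v).
have [g gK fK] := f_bij.
pose u := g (inl ord0); pose v := g (inl ord_max).
have cu : col u by rewrite /col fK.
have cv : col v by rewrite /col fK.
have neq_uv : u != v by rewrite (can_eq fK).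
have [p [up lp Up allp]] := hamG _ _ neq_uv.
have := bipartite_path colP up; rewrite lp cu cv addbT.
have sp : (size p).+1 = k.+2 + k.+2.
  rewrite -[LHS]/(size (u :: p)) -(card_uniqP Up) (eq_card (B := G)) //.
  by rewrite (bij_eq_card f_bij) card_sum !card_ord.
by have -> : odd (size p) by move/(congr1 odd): sp; rewrite oddD addbb /= => /negbFE.
Qed.

Lemma iso_complete_bipartite (G : sgraph) (I : {set G}) k :
    #|I| = k -> #|~: I| = k -> independent I -> independent (~: I) ->
    {in I & ~: I, forall u v, adj u v} ->
  graph_iso G (complete_bipartite k k).
Proof.
move=> cI cJ indI indJ IJ.
pose g (i : 'I_k + 'I_k) : G := match i with
  | inl i => enum_val (cast_ord (esym cI) i)
  | inr i => enum_val (cast_ord (esym cJ) i)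
  end.
have gI i : g (inl i) \in I by apply: enum_valP.
have gJ i : g (inr i) \in ~: I by apply: enum_valP.
have neqIJ i j : g (inl i) <> g (inr j).
  by move=> eq_g; have := gJ j; rewrite -eq_g inE gI.
have g_inj : injective g.
  case=> i [] j // eq_g.
  - by move/enum_val_inj/cast_ord_inj: eq_g => ->.
  - by case: (neqIJ _ _ eq_g).
  - by case: (neqIJ _ _ (esym eq_g)).
  - by move/enum_val_inj/cast_ord_inj: eq_g => ->.
have [f gK fK] : bijective g.
  by apply: inj_card_bij => //; rewrite card_sum !card_ord -(cardsC I) cI cJ.
exists f; first by exists g.
move=> u v; rewrite -{2}(fK u) -{2}(fK v).
case: (f u) => i; case: (f v) => j; apply/esym => /=.
- by apply/negbTE/indI; apply: gI.
- by apply: IJ; [apply: gI | apply: gJ].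
- by rewrite adj_sym; apply: IJ; [apply: gI | apply: gJ].
- by apply/negbTE/indJ; apply: gJ.
Qed.

Local Open Scope ring_scope.

(** * The spectral bound *)

Section Rayleigh.
Variables (R : realType) (n : nat) (A : 'M[R]_n).
Local Notation toC := (real_complex R).
Local Notation MC := (map_mx toC).

(** Without an upper bound, [sup] would not dominate the eigenvalues; the Cauchy bound on the roots
    of the characteristic polynomial provides one. *)
Lemma eigenvalue_has_ub : has_ubound [set a : R | eigenvalue A a]%classic.
Proof.
exists (cauchy_bound (char_poly A)) => a /=; rewrite eigenvalue_root_char => ra.
have cpn0 : char_poly A != 0 by rewrite monic_neq0 ?char_poly_monic.
by have /andP[] := root_in_cauchy_bound cpn0 ra; rewrite bnd_simp => _ /ltW.
Qed.

Lemma eigenvalue_le_sup (a : R) : eigenvalue (MC A) (toC a) ->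
  a <= sup [set a : R | eigenvalue A a]%classic.
Proof.
rewrite eigenvalue_root_char -map_char_poly fmorph_root -eigenvalue_root_char.
by move=> Aa; exact: (ub_le_sup eigenvalue_has_ub).
Qed.

(** The real matrix is diagonalised over the complex numbers by a unitary [P]. In the coordinates
    [w] of [v], both sides become weighted sums of the squared moduli of the [w 0 i]. *)
Lemma rayleigh_le (v : 'rV[R]_n) : A^T = A ->
  (v *m A *m v^T) 0 0 <= sup [set a : R | eigenvalue A a]%classic * (v *m v^T) 0 0.
Proof.
move=> symA; set l := sup _.
have hermA : MC A \is hermsymmx.
  apply: realsym_hermsym.
    apply/is_hermitianmxP; rewrite expr0 scale1r map_mx_id //.
  by rewrite map_trmx symA.
  by apply/mxOverP => i j; rewrite mxE complex_real.
have Pu := spectral_unitarymx (MC A).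
have PK : spectralmx (MC A) \in unitmx := spectral_unit (MC A).
have /orthomx_spectralP defA := hermitian_normalmx hermA.
have /mxOverP Dr := hermitian_spectral_diag_real hermA.
move: defA Dr Pu PK; set P := spectralmx _; set D := spectral_diag _.
move=> defA Dr Pu PK.
(* Row [i] of [P] is an eigenvector for [D 0 i], nonzero because [P] is invertible. *)
have Dl i : D 0 i <= toC l.
  have /complex_realP[r Dir] := Dr 0 i; rewrite Dir lecR.
  apply: eigenvalue_le_sup; apply/eigenvalueP; exists (row i P).
    rewrite -row_mul {1}defA !mulmxA mulmxV // mul1mx row_mul row_diag_mx.
    by rewrite -scalemxAl -rowE -Dir.
  apply/eqP => Pi0; have: row i (P *m invmx P) = 0.
    by rewrite row_mul Pi0 mul0mx.
  rewrite mulmxV // => /rowP/(_ i); rewrite !mxE eqxx => /eqP.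
  by rewrite oner_eq0.
have [w wE] : exists w, w = MC v *m invmx P by exists (MC v *m invmx P).
have vr : map_mx Num.conj (MC v) = MC v.
  by apply: realmxC; apply/mxOverP => i j; rewrite mxE complex_real.
(* As [P] is unitary and [v] is real, this column is the conjugate transpose of [w]. *)
have wP : P *m (MC v)^T = (map_mx Num.conj w)^T.
  rewrite wE invmx_unitary // map_mxM trmx_mul vr; congr (_ *m _).
  by rewrite -map_mx_comp (map_mx_id (@conjCK _)) trmxK.
have vAv : toC ((v *m A *m v^T) 0 0) = \sum_i D 0 i * `|w 0 i| ^+ 2.
  have -> : toC ((v *m A *m v^T) 0 0) = (MC v *m MC A *m (MC v)^T) 0 0.
    by rewrite map_trmx -!map_mxM [RHS]mxE.
  rewrite defA !mulmxA -wE -mulmxA wP mxE; apply: eq_bigr => i _.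
  by rewrite mul_mx_diag !mxE normCK mulrA [w 0 i * _]mulrC.
have vv : toC ((v *m v^T) 0 0) = \sum_i `|w 0 i| ^+ 2.
  have -> : toC ((v *m v^T) 0 0) = (MC v *m (MC v)^T) 0 0.
    by rewrite map_trmx -!map_mxM [RHS]mxE.
  rewrite -{1}[MC v](mulmxKV PK) -wE -mulmxA wP mxE; apply: eq_bigr => i _.
  by rewrite !mxE normCK.
rewrite -lecR rmorphM /= vAv vv mulr_sumr; apply: ler_sum => i _.
by apply: ler_wpM2r; rewrite ?exprn_ge0.
Qed.
End Rayleigh.

Lemma spectral_radius_ge (R : realType) (G : sgraph) (f : G -> R) :
  \sum_x f x * \sum_(y | adj x y) f y <= spectral_radius R G * \sum_x f x ^+ 2.
Proof.
pose v : 'rV[R]_#|G| := \row_j f (enum_val j).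
have symA : (adjacency_matrix R G)^T = adjacency_matrix R G.
  by apply/matrixP => i j; rewrite !mxE adj_sym.
have := rayleigh_le v symA; rewrite -mulmxA.
have -> : (v *m v^T) 0 0 = \sum_x f x ^+ 2.
  rewrite mxE [RHS](reindex (enum_val (A := G))); last exact/onW_bij/enum_val_bij.
  by apply: eq_bigr => i _; rewrite !mxE expr2.
suff -> : (v *m (adjacency_matrix R G *m v^T)) 0 0 =
    \sum_x f x * \sum_(y | adj x y) f y by [].
rewrite mxE [RHS](reindex (enum_val (A := G))); last exact/onW_bij/enum_val_bij.
apply: eq_bigr => i _; rewrite !mxE; congr (_ * _).
rewrite [RHS]big_mkcond (reindex (enum_val (A := G))); last exact/onW_bij/enum_val_bij.
by apply: eq_bigr => j _; rewrite !mxE; case: ifP; rewrite ?mul1r ?mul0r.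
Qed.

(** * Edge counting in the extremal case *)

Section Extremal.
Variables (R : realType) (G : sgraph) (k : nat) (I : {set G}).
Hypotheses (k_gt0 : (0 < k)%N) (indI : independent I) (cardI : #|I| = k).
Local Notation J := (~: I).
Let degree_in (S : {set G}) x := #|[set y in S | adj x y]|.
Local Notation m := #|J|.
(** A crossing edge is counted once, from its end in [J]; an edge inside [J] will be counted twice
    in [edges_JJ]. *)
Local Notation edges_IJ := (\sum_(x in J) degree_in I x)%N.
Local Notation edges_JJ := (\sum_(x in J) degree_in J x)%N.

Lemma degree_split x : degree x = (degree_in I x + degree_in J x)%N.
Proof.
rewrite /degree -(cardsID I); congr (_ + _)%N; apply: eq_card => y.
  by rewrite !inE andbC.
by rewrite !inE.
Qed.

Lemma degree_independent x : x \in I -> degree x = degree_in J x.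
Proof.
move=> xI; rewrite degree_split /degree_in (_ : [set y in I | _] = set0) ?cards0 //.
apply/setP => y; rewrite !inE; apply/andP => -[yI xy].
by have := indI xI yI; rewrite xy.
Qed.

Lemma sum_degree_independent : (\sum_(x in I) degree x = edges_IJ)%N.
Proof.
under eq_bigr => x xI do rewrite degree_independent // /degree_in -sum1_card.
under [RHS]eq_bigr => x xJ do rewrite /degree_in -sum1_card.
rewrite (exchange_big_dep (mem J)) => [|x y _]; last by rewrite inE => /andP[].
apply: eq_bigr => y yJ; apply: eq_bigl => x; move: yJ.
by rewrite !inE => ->; rewrite adj_sym.
Qed.

Lemma rayleigh_two_valued (a b : R) :
  2 * a * b * edges_IJ%:R + b ^+ 2 * edges_JJ%:R <=
  spectral_radius R G * (k%:R * a ^+ 2 + m%:R * b ^+ 2).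
Proof.
pose f x := if x \in I then a else b.
have := spectral_radius_ge f.
have splitI (F : G -> R) : \sum_x F x = \sum_(x in I) F x + \sum_(x in J) F x.
  rewrite (bigID (mem I)); congr (_ + _); apply: eq_bigl => x.
  by rewrite in_setC.
have fI x : x \in I -> f x = a by rewrite /f => ->.
have fJ x : x \in J -> f x = b by rewrite /f inE => /negbTE ->.
have fN x : \sum_(y | adj x y) f y = a *+ degree_in I x + b *+ degree_in J x.
  rewrite (bigID (mem I)); congr (_ + _).
    rewrite -sumr_const; apply: eq_big => y; first by rewrite !inE andbC.
    by case/andP => _ /fI.
  rewrite -sumr_const; apply: eq_big => y; first by rewrite !inE andbC.
  by case/andP => _ yI; rewrite fJ // inE.
have -> : \sum_x f x ^+ 2 = k%:R * a ^+ 2 + m%:R * b ^+ 2.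
  rewrite splitI (eq_bigr (fun=> a ^+ 2)) => [|x /fI -> //].
  rewrite [X in _ + X](eq_bigr (fun=> b ^+ 2)) => [|x /fJ -> //].
  by rewrite !sumr_const cardI !mulr_natl.
suff -> : \sum_x f x * \sum_(y | adj x y) f y =
  2 * a * b * edges_IJ%:R + b ^+ 2 * edges_JJ%:R by [].
rewrite splitI.
have -> : \sum_(x in I) f x * \sum_(y | adj x y) f y = a * b * edges_IJ%:R.
  rewrite -sum_degree_independent natr_sum mulr_sumr; apply: eq_bigr => x xI.
  have dI0 : degree_in I x = 0%N.
    by have := degree_split x; rewrite degree_independent //; lia.
  rewrite fN fI // dI0 mulr0n add0r.
  by rewrite degree_independent // -[b *+ _]mulr_natr mulrA.
have -> : \sum_(x in J) f x * \sum_(y | adj x y) f y =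
    a * b * edges_IJ%:R + b ^+ 2 * edges_JJ%:R.
  rewrite !natr_sum !mulr_sumr -big_split /=; apply: eq_bigr => x xJ.
  by rewrite fN fJ // -[a *+ _]mulr_natr -[b *+ _]mulr_natr; ring.
by ring.
Qed.

(** With weights [s = sqrt m] on [I] and [t = sqrt k] on [J], the squared norm is [2 * k * m], and
    the hypothesis gives [2 * s * t * edges_IJ + t ^+ 2 * edges_JJ <= 2 * s * t * (k * d)]. The
    degrees in [I] already force [k * d <= edges_IJ], so no slack is left. *)
Lemma extremal_edges (d : nat) :
    (0 < m)%N -> (forall x : G, (d <= degree x)%N) ->
    spectral_radius R G <= d%:R * Num.sqrt (k%:R / m%:R) ->
  edges_JJ = 0%N /\ (edges_IJ <= k * d)%N.
Proof.
move=> m_gt0 ge_d lam.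
have kR : 0 < k%:R :> R by rewrite ltr0n.
have mR : 0 < m%:R :> R by rewrite ltr0n.
pose t : R := Num.sqrt k%:R; pose s : R := Num.sqrt m%:R.
have t_gt0 : 0 < t by rewrite sqrtr_gt0.
have s_gt0 : 0 < s by rewrite sqrtr_gt0.
have tE : t ^+ 2 = k%:R by rewrite sqr_sqrtr // ltW.
have sE : s ^+ 2 = m%:R by rewrite sqr_sqrtr // ltW.
have := rayleigh_two_valued s t; rewrite -tE -sE => ray.
have le_lam : spectral_radius R G * (t ^+ 2 * s ^+ 2 + s ^+ 2 * t ^+ 2) <=
    2 * s * t * (k * d)%:R.
  have -> : 2 * s * t * (k * d)%:R =
      (d%:R * (t / s)) * (t ^+ 2 * s ^+ 2 + s ^+ 2 * t ^+ 2).
    by rewrite natrM -tE; field; rewrite gt_eqF.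
  apply: ler_wpM2r; first by rewrite addr_ge0 // mulr_ge0 ?sqr_ge0.
  by move: lam; rewrite (sqrtrM _ (ltW kR)) (sqrtrV (ltW mR)).
have le_kd : (k * d <= edges_IJ)%N.
  rewrite -sum_degree_independent -cardI -sum_nat_const.
  by apply: leq_sum => x _; apply: ge_d.
have st : 0 < 2 * s * t by rewrite !mulr_gt0.
have le_main := le_trans ray le_lam.
have t2 : 0 < t ^+ 2 by rewrite exprn_gt0.
have JJ0 : 0 <= edges_JJ%:R :> R by [].
split.
  apply/eqP; rewrite -(pnatr_eq0 R) eq_le ler0n andbT.
  rewrite -(pmulr_rle0 _ t2).
  have := ler_wpM2l (ltW st) (_ : (k * d)%:R <= edges_IJ%:R :> R).
  by rewrite ler_nat => /(_ le_kd); lra.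
rewrite -(ler_nat R) -(ler_pM2l st); apply: le_trans le_main.
by rewrite lerDl mulr_ge0 // ltW.
Qed.

(** Since [J] is independent, [m * d <= edges_IJ <= k * d], whence [m <= k]. Conversely a vertex of
    [I] has at least [d >= k] neighbours, all in [J], so it is joined to all of [J] and [m = k]. *)
Lemma extremal_complete_bipartite (d : nat) :
    (k <= d)%N -> (0 < m)%N -> (forall x : G, (d <= degree x)%N) ->
    spectral_radius R G <= d%:R * Num.sqrt (k%:R / m%:R) ->
  graph_iso G (complete_bipartite k k).
Proof.
move=> kd m_gt0 ge_d /(extremal_edges m_gt0 ge_d)[/eqP JJ0 IJ].
have degJ0 x : x \in J -> degree_in J x = 0%N.
  by move: JJ0; rewrite sum_nat_eq0 => /forall_inP/[apply]/eqP.
have le_mk : (m <= k)%N.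
  have : (m * d <= edges_IJ)%N.
    rewrite -sum_nat_const; apply: leq_sum => x xJ.
    by rewrite -[degree_in I x]addn0 -(degJ0 x xJ) -degree_split; apply: ge_d.
  by move=> /leq_trans/(_ IJ); rewrite leq_pmul2r //; lia.
have nbrs x : x \in I -> [set y in J | adj x y] = J.
  move=> xI; apply/eqP; rewrite eqEcard; apply/andP; split.
    by apply/subsetP => y; rewrite inE => /andP[].
  have := ge_d x; rewrite degree_independent // /degree_in; lia.
have [x0 x0I] : exists x0, x0 \in I by apply/set0Pn; rewrite -card_gt0 cardI.
have cJ : m = k.
  have := ge_d x0; rewrite degree_independent // /degree_in nbrs //; lia.
apply: (iso_complete_bipartite cardI cJ indI).
  move=> u v uJ vJ; apply/negP => uv; have := degJ0 u uJ.
  by move/eqP; rewrite cards_eq0 => /eqP/setP/(_ v); rewrite inE vJ uv inE.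
by move=> u v uI vJ; move: (vJ); rewrite -(nbrs u uI) inE => /andP[].
Qed.
End Extremal.

Theorem theorem1p2 (R : realType) (k n : nat) (G : sgraph)
    (k_gt0 : (0 < k)%N)
    (order_G : #|G| = n)
    (n_ge3 : (3 <= n)%N)
    (conn_G : connected_graph G)
    (kconn_G : k_connected k G)
    (lambda1_le : spectral_radius R G <=
       (min_degree G)%:R * Num.sqrt (k%:R / (n%:R - k%:R))) :
  hamiltonian_connected G <-> ~ graph_iso G (complete_bipartite k k).
Proof.
split=> [hamG isoG | not_iso x y neq_xy].
  apply: (complete_bipartite_not_hamiltonian_connected _ isoG hamG).
  (* The isomorphism gives [n = 2k], and [3 <= n] then yields [2 <= k]. *)
  case: isoG => f f_bij _; have := bij_eq_card f_bij.
  by rewrite order_G card_sum !card_ord; lia.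
have [//|[I0 [indI0 le_kI0]]] :=
  hamiltonian_path_or_independent kconn_G conn_G neq_xy.
case: not_iso.
(* The independent set is cut down to exactly [k] elements, so that its complement has the [n - k]
   elements of the bound. *)
pose I := [set z in take k (enum I0)].
have subI : {subset I <= I0} by move=> z; rewrite inE => /mem_take; rewrite mem_enum.
have cardI : #|I| = k.
  rewrite cardsE (card_uniqP _) ?take_uniq ?enum_uniq // size_takel //.
  by rewrite -cardE.
have indI : independent I by move=> u v /subI uI /subI; apply: indI0.
have lt_kG := k_connected_lt_order x kconn_G.
have cardJ : #|~: I| = (n - k)%N by rewrite -cardI -order_G -(cardsC I) addKn.
apply: (@extremal_complete_bipartite R G k I k_gt0 indI cardI (min_degree G)).
(* The default value [#|G|] of the minimum must be at least [k] as well. *)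
- apply: leq_bigminn; first exact: ltnW.
  by move=> z; apply: k_connected_leq_degree.
- by rewrite cardJ subn_gt0 -order_G.
- by move=> z; apply: geq_bigminn.
(* The truncated [n - k] agrees with the real difference because [k < n]. *)
- by rewrite cardJ natrB // -order_G ltnW.
Qed.
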